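(* Let $q$ be a prime power and let $\mathrm{GH}(q)=(\mathcal P,\mathcal L,\mathrm I)$ be the split Cayley hexagon in its standard representation inside the parabolic quadric $\mathrm Q(6,q)$ in $\mathrm{PG}(6,q)$. Let $S$ be a $4$-dimensional projective subspace of $\mathrm{PG}(6,q)$ and let $A$ be a point of $S\cap\mathrm Q(6,q)$. Let $\pi_A$ be the $\mathrm{GH}(q)$-plane with centre $A$ (the plane spanned by the $q+1$ lines of $\mathcal L$ through $A$). Define \[\mathcal P_1=\{X\in\mathcal P:\mathrm d(X,A)\le 4\},\quad \mathcal P_2=\{X\in\mathcal P: X\in S\},\quad \mathcal P_3=\{X\in\mathcal P: X\notin S,\ |\Gamma_2(X)\cap S|\ne 1\},\] \[\mathcal L_1=\{n\in\mathcal L: n\cap S\neq\varnothing\},\quad \mathcal L_2=\{n\in\mathcal L: n\cap\pi_A\ne\varnothing\}.\] Then $\overline{\mathcal P}=\mathcal P_1\cup\mathcal P_2\cup\mathcal P_3$ and $\overline{\mathcal L}=\mathcal L_1\cup\mathcal L_2$ form a $1$-good structure in $\mathrm{GH}(q)$.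
   Context: $\mathrm Q(6,q)$ is the non-singular parabolic quadric in $\mathrm{PG}(6,q)$ (quadratic form equivalent to $x_0^2+x_1x_2+x_3x_4+x_5x_6$). The split Cayley hexagon $\mathrm{GH}(q)$ (Tits) is the generalized hexagon of order $(q,q)$ whose points are all points of $\mathrm Q(6,q)$ and whose lines are a certain subset of the lines of $\mathrm Q(6,q)$ (those whose Grassmann coordinates satisfy Tits' standard linear conditions). Standard facts: the $q+1$ lines of $\mathrm{GH}(q)$ through a point $P$ span a totally singular plane $\pi_P$, the $\mathrm{GH}(q)$-plane with centre $P$; every plane of $\mathrm Q(6,q)$ is either a $\mathrm{GH}(q)$-plane or contains no $\mathrm{GH}(q)$-line. $\mathrm d(x,y)$ denotes distance in the point-line incidence graph of $\mathrm{GH}(q)$, and $\Gamma_2(X)$ is the set of points at distance $2$ from $X$ (i.e. points distinct from $X$ lying on a common $\mathrm{GH}(q)$-line with $X$). A $1$-good structure is a pair $\overline{\mathcal P}\subseteq\mathcal P$, $\overline{\mathcal L}\subseteq\mathcal L$ such that every point not in $\overline{\mathcal P}$ is incident with exactly one line of $\overline{\mathcal L}$ and every line not in $\overline{\mathcal L}$ is incident with exactly one point of $\overline{\mathcal P}$. *)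

(* Defs.v *)
From HB Require Import structures.
From mathcomp Require Import all_boot all_order all_algebra all_field.

Set Implicit Arguments.
Unset Strict Implicit.
Unset Printing Implicit Defensive.

Import GRing.Theory.
Local Open Scope ring_scope.

(* Finite vector spaces have finitely many subspaces; vector.v only gives
   {vspace vT} a choiceType structure. *)
Section VspaceFinite.

Import VectorInternalTheory.
Variables (F : finFieldType) (vT : vectType F).

HB.instance Definition _ := [Countable of {vspace vT} by <:].
HB.instance Definition _ := [Finite of {vspace vT} by <:].

End VspaceFinite.

Section Incidence.

Variables (P L : finType) (I : P -> L -> bool).

Definition one_good (Pbar : {set P}) (Lbar : {set L}) : Prop :=
  (forall p, p \notin Pbar -> #|[set l in Lbar | I p l]| = 1%N) /\
  (forall l, l \notin Lbar -> #|[set p in Pbar | I p l]| = 1%N).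

Definition incidence_graph : rel (P + L) := fun u v =>
  match u, v with
  | inl p, inr l => I p l
  | inr l, inl p => I p l
  | _, _ => false
  end.

End Incidence.

(* Length of a shortest e-path from x to y; a shortest path has length less
   than #|T|, and the value #|T| stands for "no path". *)
Definition gdist (T : finType) (e : rel T) (x y : T) : nat :=
  find (fun n => [exists p : n.-tuple T, path e x p && (last x p == y)])
       (iota 0 #|T|).

Section SplitCayleyHexagon.

Variable F : finFieldType.

(* A subspace of PG(6,q) of projective dimension d is a vector subspace of
   F^7 of dimension d.+1; the empty subspace is 0%VS. *)
Local Notation V := 'rV[F]_7.

Definition hcoord (x : V) (i : nat) : F := x ord0 (inord i).

(* Q(6,q) in Tits' coordinates: X0 X4 + X1 X5 + X2 X6 = X3^2. *)
Definition qform (x : V) : F :=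
  hcoord x 0 * hcoord x 4 + hcoord x 1 * hcoord x 5 + hcoord x 2 * hcoord x 6
  - hcoord x 3 ^+ 2.

Definition totally_singular (U : {vspace V}) : bool :=
  [forall x : V, (x \in U) ==> (qform x == 0)].

Definition grassmann (x y : V) (i j : nat) : F :=
  hcoord x i * hcoord y j - hcoord x j * hcoord y i.

Definition tits_conditions (x y : V) : bool :=
  let p := grassmann x y in
  [&& p 1 2 == p 3 4, p 5 4 == p 3 2, p 2 0 == p 3 5,
      p 6 5 == p 3 0, p 0 1 == p 3 6 & p 4 6 == p 3 1]%N.

Definition is_hpoint (U : {vspace V}) : bool :=
  (\dim U == 1%N) && totally_singular U.

(* Grassmann coordinates are defined up to a common nonzero factor, so the
   homogeneous conditions do not depend on the spanning pair. *)
Definition is_hline (U : {vspace V}) : bool :=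
  [&& \dim U == 2%N, totally_singular U &
      [forall x : V, forall y : V,
         (U == <[x]> + <[y]>)%VS ==> tits_conditions x y]].

Definition hpoint := {U : {vspace V} | is_hpoint U}.
Definition hline := {U : {vspace V} | is_hline U}.

HB.instance Definition _ := Finite.on hpoint.
HB.instance Definition _ := Finite.on hline.

Definition hincident (X : hpoint) (n : hline) : bool := (val X <= val n)%VS.

(* d(X, Y) for two points of GH(q). *)
Definition hdist (X Y : hpoint) : nat :=
  gdist (incidence_graph hincident) (inl X) (inl Y).

Definition Gamma2 (X : hpoint) : {set hpoint} := [set Y | hdist X Y == 2%N].

Definition hplane (A : hpoint) : {vspace V} :=
  (\sum_(n : hline | hincident A n) val n)%VS.

Definition points_in (S : {vspace V}) : {set hpoint} :=
  [set X | (val X <= S)%VS].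

Definition lines_meeting (S : {vspace V}) : {set hline} :=
  [set n | (val n :&: S != 0)%VS].

Definition P1 (A : hpoint) : {set hpoint} := [set X | (hdist X A <= 4)%N].

Definition P2 (S : {vspace V}) : {set hpoint} := points_in S.

Definition P3 (S : {vspace V}) : {set hpoint} :=
  [set X | ~~ (val X <= S)%VS & #|Gamma2 X :&: points_in S| != 1%N].

Definition L1 (S : {vspace V}) : {set hline} := lines_meeting S.

Definition L2 (A : hpoint) : {set hline} := lines_meeting (hplane A).

End SplitCayleyHexagon.

(* Main.v *)
Require Import Defs.
From mathcomp Require Import all_boot all_order all_algebra all_field.
From HB Require Import structures.
From mathcomp Require Import ring.

(* A point [y] is on a hexagon line with the point [x] iff [coll x y], and such
   [y] fill a totally singular plane [U_x], equal to its own singular perp.  If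
   [y] is in [x^perp], the octonion product [cross x y] yields a point of
   [U_x :&: U_y]; hence distance at most 4 means perpendicularity.

   Let [p] be outside [Pbar].  A line on [p] that meets [pi_A] would put [p] at
   distance at most 4 from [A], and the lines on [p] that meet [S] correspond to
   the points of [Gamma2 p] in [S], of which there is one.

   Let [l] be outside [Lbar].  For [p] on [l] the plane [U_p] contains [l],
   which misses the codimension 2 space [S], so [U_p] meets [S] in one point
   and [p] is not in [P3].  The points of [l] in [P1] are those in [A^perp];
   there is one, since a line inside [A^perp] meets [pi_A]. *)

Set Implicit Arguments.
Unset Strict Implicit.
Unset Printing Implicit Defensive.

Import GRing.Theory.

(** * The quadric, its polar form and collinearity in coordinates *)

Section Coordinates.

Local Open Scope ring_scope.

Variable F : finFieldType.
Local Notation V := 'rV[F]_7.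
Implicit Types (x y z a : V) (U : {vspace V}).

Definition mk7 (s : seq F) : V := \row_j s`_j.

Lemma hcoord_mk7 s i : (i < 7)%N -> hcoord (mk7 s) i = s`_i.
Proof. by move=> lti; rewrite /hcoord mxE inordK. Qed.

Lemma hcoordP x y :
  (forall i, (i < 7)%N -> hcoord x i = hcoord y i) -> x = y.
Proof.
move=> eqxy; apply/rowP => j; have := eqxy j (ltn_ord j).
by rewrite /hcoord inord_val (ord1 ord0).
Qed.

Lemma hcoord7P x y :
  hcoord x 0 = hcoord y 0 -> hcoord x 1 = hcoord y 1 ->
  hcoord x 2 = hcoord y 2 -> hcoord x 3 = hcoord y 3 ->
  hcoord x 4 = hcoord y 4 -> hcoord x 5 = hcoord y 5 ->
  hcoord x 6 = hcoord y 6 -> x = y.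
Proof. by move=> *; apply: hcoordP; do 7!case=> //. Qed.

Lemma hcoordD x y i : hcoord (x + y) i = hcoord x i + hcoord y i.
Proof. by rewrite /hcoord mxE. Qed.

Lemma hcoordZ k x i : hcoord (k *: x) i = k * hcoord x i.
Proof. by rewrite /hcoord mxE. Qed.

Lemma hcoordN x i : hcoord (- x) i = - hcoord x i.
Proof. by rewrite /hcoord mxE. Qed.

Lemma hcoord0 i : hcoord (0 : V) i = 0.
Proof. by rewrite /hcoord mxE. Qed.

Definition hcoordE := (hcoordD, hcoordZ, hcoordN, hcoord0).

(** The polar form of [qform], in a shape valid in every characteristic. *)
Definition bform x y : F :=
  hcoord x 0 * hcoord y 4 + hcoord x 4 * hcoord y 0
  + (hcoord x 1 * hcoord y 5 + hcoord x 5 * hcoord y 1)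
  + (hcoord x 2 * hcoord y 6 + hcoord x 6 * hcoord y 2)
  - hcoord x 3 * hcoord y 3 *+ 2.

(** Perpendicularity makes the span of two singular vectors totally singular. Both conditions are
    linear in [y], so the vectors collinear with [x] form a subspace. *)
Definition coll x y : bool := tits_conditions x y && (bform x y == 0).

Lemma qformD x y : qform (x + y) = qform x + qform y + bform x y.
Proof. rewrite /qform /bform !hcoordE; ring. Qed.

Lemma qformZ k x : qform (k *: x) = k ^+ 2 * qform x.
Proof. rewrite /qform !hcoordE; ring. Qed.

Lemma bformC x y : bform x y = bform y x.
Proof. rewrite /bform; ring. Qed.

Lemma bformDr x y z : bform x (y + z) = bform x y + bform x z.
Proof. rewrite /bform !hcoordE; ring. Qed.

Lemma bformZr k x y : bform x (k *: y) = k * bform x y.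
Proof. rewrite /bform !hcoordE; ring. Qed.

Lemma bformxx x : bform x x = qform x *+ 2.
Proof. rewrite /bform /qform; ring. Qed.

Lemma grassmannDr x y z i j :
  grassmann x (y + z) i j = grassmann x y i j + grassmann x z i j.
Proof. rewrite /grassmann !hcoordE; ring. Qed.

Lemma grassmannZr k x y i j : grassmann x (k *: y) i j = k * grassmann x y i j.
Proof. rewrite /grassmann !hcoordE; ring. Qed.

Lemma grassmannC x y i j : grassmann y x i j = - grassmann x y i j.
Proof. rewrite /grassmann; ring. Qed.

Lemma grassmannxx x i j : grassmann x x i j = 0.
Proof. rewrite /grassmann; ring. Qed.

Lemma titsC x y : tits_conditions y x = tits_conditions x y.
Proof. by rewrite /tits_conditions !(grassmannC x y) !eqr_opp. Qed.

Lemma titsxx x : tits_conditions x x.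
Proof. by rewrite /tits_conditions !grassmannxx !eqxx. Qed.

Lemma titsP x y : reflect
  ([/\ grassmann x y 1 2 = grassmann x y 3 4,
       grassmann x y 5 4 = grassmann x y 3 2 &
       grassmann x y 2 0 = grassmann x y 3 5] /\
   [/\ grassmann x y 6 5 = grassmann x y 3 0,
       grassmann x y 0 1 = grassmann x y 3 6 &
       grassmann x y 4 6 = grassmann x y 3 1]) (tits_conditions x y).
Proof.
rewrite /tits_conditions; apply: (iffP idP).
  by case/and5P=> /eqP-> /eqP-> /eqP-> /eqP-> /andP[/eqP-> /eqP->].
by case=> [[-> -> ->] [-> -> ->]]; rewrite !eqxx.
Qed.

Lemma titsDr x y z :
  tits_conditions x y -> tits_conditions x z -> tits_conditions x (y + z).
Proof.
case/titsP=> [[y1 y2 y3] [y4 y5 y6]] /titsP[[z1 z2 z3] [z4 z5 z6]].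
by apply/titsP; rewrite !grassmannDr y1 y2 y3 y4 y5 y6 z1 z2 z3 z4 z5 z6.
Qed.

Lemma titsZr k x y : tits_conditions x y -> tits_conditions x (k *: y).
Proof.
case/titsP=> [[y1 y2 y3] [y4 y5 y6]].
by apply/titsP; rewrite !grassmannZr y1 y2 y3 y4 y5 y6.
Qed.

Lemma collC x y : coll y x = coll x y.
Proof. by rewrite /coll titsC bformC. Qed.

Lemma collDr x y z : coll x y -> coll x z -> coll x (y + z).
Proof.
case/andP=> ? /eqP Bxy /andP[? /eqP Bxz].
by rewrite /coll titsDr // bformDr Bxy Bxz addr0 eqxx.
Qed.

Lemma collZr k x y : coll x y -> coll x (k *: y).
Proof.
by case/andP=> ? /eqP Bxy; rewrite /coll titsZr // bformZr Bxy mulr0 eqxx.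
Qed.

Lemma collZl k x y : coll x y -> coll (k *: x) y.
Proof. by rewrite collC => /(collZr k); rewrite collC. Qed.

Lemma collxx x : qform x = 0 -> coll x x.
Proof. by move=> qx; rewrite /coll titsxx bformxx qx mul0rn eqxx. Qed.

(** The vector space of the hexagon plane with centre [x]. The last clause is maximality among
    totally singular subspaces; it is restricted to singular [a] because the perp of [U] has
    dimension 4. *)
Definition coll_space x U : Prop :=
  [/\ \dim U = 3,
      forall y, (y \in U) = coll x y,
      forall y, y \in U -> qform y = 0
    & forall a, qform a = 0 -> (forall y, y \in U -> bform a y = 0) -> a \in U].

(** * Two linear symmetries of the hexagon *)

Definition rot x : V :=
  mk7 [:: hcoord x 1; hcoord x 2; hcoord x 0; hcoord x 3;
          hcoord x 5; hcoord x 6; hcoord x 4].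

(* The sign on coordinate 3 is what preserves the Tits conditions. *)
Definition swp x : V :=
  mk7 [:: hcoord x 4; hcoord x 5; hcoord x 6; - hcoord x 3;
          hcoord x 0; hcoord x 1; hcoord x 2].

Lemma rot_linear : linear rot.
Proof.
by move=> k x y; apply: hcoord7P;
  rewrite hcoordD hcoordZ !hcoord_mk7 //= !hcoordE.
Qed.

Lemma swp_linear : linear swp.
Proof.
move=> k x y; apply: hcoord7P;
  rewrite hcoordD hcoordZ !hcoord_mk7 //= !hcoordE //.
ring.
Qed.

HB.instance Definition _ := GRing.isLinear.Build F V V *:%R rot rot_linear.
HB.instance Definition _ := GRing.isLinear.Build F V V *:%R swp swp_linear.

Lemma rotK3 x : rot (rot (rot x)) = x.
Proof. by apply: hcoord7P; rewrite !hcoord_mk7. Qed.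

Lemma swpK : involutive swp.
Proof. by move=> x; apply: hcoord7P; rewrite !hcoord_mk7 //= opprK. Qed.

Lemma qform_rot x : qform (rot x) = qform x.
Proof. rewrite /qform !hcoord_mk7 //=; ring. Qed.

Lemma qform_swp x : qform (swp x) = qform x.
Proof. rewrite /qform !hcoord_mk7 //=; ring. Qed.

Lemma polar_morph (g : {linear V -> V}) :
  (forall x, qform (g x) = qform x) ->
  forall x y, bform (g x) (g y) = bform x y.
Proof.
move=> gq x y; have := qformD (g x) (g y).
by rewrite -linearD !gq qformD => /addrI.
Qed.

Lemma coll_rot x y : coll (rot x) (rot y) = coll x y.
Proof.
rewrite /coll (polar_morph qform_rot); congr (_ && _).
by apply/titsP/titsP; rewrite /grassmann !hcoord_mk7 //=;
  case=> [[? ? ?] [? ? ?]].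
Qed.

Lemma coll_swp x y : coll (swp x) (swp y) = coll x y.
Proof.
rewrite /coll (polar_morph qform_swp); congr (_ && _).
(* Each Tits condition on one pair is, up to sign, a Tits condition on the other: the differences of
   the two sides agree or are opposite. The search below tries the six hypotheses with both
   signs. *)
have sub0 (c d e f : F) : c = d -> e - f = c - d -> e = f.
  by move=> ->; rewrite subrr => /eqP; rewrite subr_eq0 => /eqP.
have sub0' (c d e f : F) : c = d -> e - f = d - c -> e = f.
  by move/esym; apply: sub0.
apply/titsP/titsP; rewrite /grassmann !hcoord_mk7 //=;
  case=> [[h1 h2 h3] [h4 h5 h6]]; do 2!split;
  first [apply: (sub0 _ _ _ _ h1); ring | apply: (sub0' _ _ _ _ h1); ring
    | apply: (sub0 _ _ _ _ h2); ring | apply: (sub0' _ _ _ _ h2); ring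
    | apply: (sub0 _ _ _ _ h3); ring | apply: (sub0' _ _ _ _ h3); ring
    | apply: (sub0 _ _ _ _ h4); ring | apply: (sub0' _ _ _ _ h4); ring
    | apply: (sub0 _ _ _ _ h5); ring | apply: (sub0' _ _ _ _ h5); ring
    | apply: (sub0 _ _ _ _ h6); ring | apply: (sub0' _ _ _ _ h6); ring].
Qed.

(** The preimage of [U] under [g] serves; it is written as the image under the inverse [g']. *)
Lemma coll_space_transport (g g' : {linear V -> V}) x U :
  cancel g g' -> cancel g' g -> (forall x, qform (g x) = qform x) ->
  (forall x y, coll (g x) (g y) = coll x y) ->
  coll_space (g x) U -> exists U', coll_space x U'.
Proof.
move=> gK g'K gq gc [dU cU qU mU].
have memU y : (y \in linfun g' @: U)%VS = (g y \in U).
  apply/memv_imgP/idP => [[u uU ->] | gyU]; first by rewrite lfunE /= g'K.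
  by exists (g y); rewrite ?lfunE /= ?gK.
exists (linfun g' @: U)%VS; split=> [|y|y|a qa aU].
- rewrite limg_dim_eq // (_ : lker _ = 0%VS) ?capv0 //.
  by apply/eqP/lker0P => u v; rewrite !lfunE => /(can_inj g'K).
- by rewrite memU cU gc.
- by rewrite memU -gq; apply: qU.
rewrite memU; apply: mU; first by rewrite gq.
move=> y yU; rewrite -[y]g'K (polar_morph gq); apply: aU.
by rewrite memU g'K.
Qed.

(* For perpendicular singular [x] and [y] this is, up to sign, their product as
   trace-zero split octonions. *)
Definition cross x y : V :=
  mk7 [:: grassmann x y 3 0 - grassmann x y 6 5;
    grassmann x y 3 1 - grassmann x y 4 6;
    grassmann x y 3 2 - grassmann x y 5 4;
    hcoord x 3 * hcoord y 3 - hcoord x 0 * hcoord y 4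
      - hcoord x 1 * hcoord y 5 - hcoord x 2 * hcoord y 6;
    grassmann x y 1 2 - grassmann x y 3 4;
    grassmann x y 2 0 - grassmann x y 3 5;
    grassmann x y 0 1 - grassmann x y 3 6].

Lemma coll_cross x y :
  qform x = 0 -> qform y = 0 -> bform x y = 0 ->
  coll x (cross x y) /\ coll y (cross x y).
Proof.
move=> qx qy bxy.
(* The required identities hold modulo [qform x] and [bform x y] (for [y], modulo [qform y] and
   [bform x y]); [e] and [f] are the explicit coefficients of these combinations. *)
have E c d e f : c - d = e * qform x + f * bform x y -> c = d.
  by rewrite qx bxy !mulr0 addr0 => /eqP; rewrite subr_eq0 => /eqP.
have E' c d e f : c - d = e * qform y + f * bform x y -> c = d.
  by rewrite qy bxy !mulr0 addr0 => /eqP; rewrite subr_eq0 => /eqP.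
split; apply/andP; split.
- apply/titsP; do 2!split; rewrite /cross /grassmann !hcoord_mk7 //=.
  + apply: (E _ _ (- hcoord y 4) 0); rewrite /qform /bform; ring.
  + apply: (E _ _ (hcoord y 2) (- hcoord x 2)); rewrite /qform /bform; ring.
  + apply: (E _ _ (- hcoord y 5) 0); rewrite /qform /bform; ring.
  + apply: (E _ _ (hcoord y 0) (- hcoord x 0)); rewrite /qform /bform; ring.
  + apply: (E _ _ (- hcoord y 6) 0); rewrite /qform /bform; ring.
  + apply: (E _ _ (hcoord y 1) (- hcoord x 1)); rewrite /qform /bform; ring.
- apply/eqP/(E _ _ 0 (hcoord x 3)).
  rewrite /cross {1}/bform /grassmann !hcoord_mk7 //= /qform /bform; ring.
- apply/titsP; do 2!split; rewrite /cross /grassmann !hcoord_mk7 //=.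
  + apply: (E' _ _ (hcoord x 4) (- hcoord y 4)); rewrite /qform /bform; ring.
  + apply: (E' _ _ (- hcoord x 2) 0); rewrite /qform /bform; ring.
  + apply: (E' _ _ (hcoord x 5) (- hcoord y 5)); rewrite /qform /bform; ring.
  + apply: (E' _ _ (- hcoord x 0) 0); rewrite /qform /bform; ring.
  + apply: (E' _ _ (hcoord x 6) (- hcoord y 6)); rewrite /qform /bform; ring.
  + apply: (E' _ _ (- hcoord x 1) 0); rewrite /qform /bform; ring.
apply/eqP/(E' _ _ 0 (hcoord y 3)).
rewrite /cross {1}/bform /grassmann !hcoord_mk7 //= /qform /bform; ring.
Qed.

(** Apart from coordinate 3, the coordinates of [cross x y] are, up to sign, the differences between
    the two sides of the six Tits conditions. *)
Lemma cross_eq0 x y : bform x y = 0 -> cross x y = 0 -> coll x y.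
Proof.
move=> bxy c0; apply/andP; rewrite bxy eqxx; split=> //.
have {}c0 i : (i < 7)%N -> hcoord (cross x y) i = 0 by rewrite c0 hcoord0.
apply/titsP; do 2!split; apply/eqP; rewrite -subr_eq0.
- by rewrite -(c0 4) // hcoord_mk7.
- by rewrite -oppr_eq0 opprB -(c0 2) // hcoord_mk7.
- by rewrite -(c0 5) // hcoord_mk7.
- by rewrite -oppr_eq0 opprB -(c0 0) // hcoord_mk7.
- by rewrite -(c0 6) // hcoord_mk7.
by rewrite -oppr_eq0 opprB -(c0 1) // hcoord_mk7.
Qed.

(** * The hexagon plane of a point *)

Definition coll_param x (v : 'rV[F]_3) : V :=
  let x_ := hcoord x in
  let s := v 0 0 in let t := v 0 1 in let u := v 0 2%:R in
  let y3 := x_ 3%N * s + x_ 5%N * u - x_ 6%N * t in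
  let y2 := x_ 2%N * s - x_ 3%N * t + x_ 5%N * y3 in
  let y1 := x_ 1%N * s + x_ 3%N * u - x_ 6%N * y3 in
  let y4 := x_ 3%N * y3 *+ 2 - x_ 4%N * s - x_ 1%N * t - x_ 5%N * y1
            - x_ 2%N * u - x_ 6%N * y2 in
  mk7 [:: s; y1; y2; y3; y4; t; u].

Lemma coll_param_linear x : linear (coll_param x).
Proof.
move=> k v w; apply: hcoord7P;
  rewrite hcoordD hcoordZ !hcoord_mk7 //= !mxE; ring.
Qed.

HB.instance Definition _ x :=
  GRing.isLinear.Build F 'rV[F]_3 V *:%R (coll_param x) (coll_param_linear x).

(** With [hcoord x 0 = 1], the Tits conditions for [p 3 0], [p 3 5], [p 3 6] and the equation
    [bform x y = 0] solve for coordinates 3, 2, 1 and 4 of [y] in terms of coordinates 0, 5 and 6;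
    [coll_param] is that solution. The other three conditions follow once [qform x = 0] eliminates
    coordinate 4 of [x]. *)
Lemma coll_paramP x y : hcoord x 0 = 1 -> qform x = 0 ->
  coll x y =
  (y == coll_param x (\row_j [:: hcoord y 0; hcoord y 5; hcoord y 6]`_j)).
Proof.
move=> x0 qx; have x4 : hcoord x 4
    = hcoord x 3 ^+ 2 - hcoord x 1 * hcoord x 5 - hcoord x 2 * hcoord x 6.
  by apply/eqP; rewrite -subr_eq0 -qx /qform x0; apply/eqP; ring.
apply/idP/eqP => [|->].
  case/andP=> /titsP[[_ _ e2] [e3 e1 _]] /eqP e4.
  have y3 : hcoord y 3 = hcoord x 3 * hcoord y 0 + hcoord x 5 * hcoord y 6
                         - hcoord x 6 * hcoord y 5.
    apply/eqP; rewrite -subr_eq0; move/eqP: e3; rewrite -subr_eq0.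
    rewrite /grassmann x0 => /eqP <-; apply/eqP; ring.
  have y2 : hcoord y 2 = hcoord x 2 * hcoord y 0 - hcoord x 3 * hcoord y 5
                         + hcoord x 5 * hcoord y 3.
    apply/eqP; rewrite -subr_eq0; move/esym/eqP: e2; rewrite -subr_eq0.
    rewrite /grassmann x0 => /eqP <-; apply/eqP; ring.
  have y1 : hcoord y 1 = hcoord x 1 * hcoord y 0 + hcoord x 3 * hcoord y 6
                         - hcoord x 6 * hcoord y 3.
    apply/eqP; rewrite -subr_eq0; move/eqP: e1; rewrite -subr_eq0.
    rewrite /grassmann x0 => /eqP <-; apply/eqP; ring.
  apply: hcoord7P; rewrite !hcoord_mk7 //= !mxE /= -?y3 //.
    by rewrite -y1 -y2; apply/eqP; rewrite -subr_eq0 -e4 /bform x0;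
      apply/eqP; ring.
rewrite /coll; apply/andP; split.
  by apply/titsP; rewrite /grassmann !hcoord_mk7 //= !mxE /= x0 x4;
    do 2!split; ring.
by apply/eqP; rewrite /bform !hcoord_mk7 //= !mxE /= x0 x4; ring.
Qed.

Lemma coll_space_base x :
  hcoord x 0 = 1 -> qform x = 0 -> exists U, coll_space x U.
Proof.
move=> x0 qx; have x4 : hcoord x 4
    = hcoord x 3 ^+ 2 - hcoord x 1 * hcoord x 5 - hcoord x 2 * hcoord x 6.
  by apply/eqP; rewrite -subr_eq0 -qx /qform x0; apply/eqP; ring.
have memU y : (y \in limg (linfun (coll_param x))) = coll x y.
  rewrite coll_paramP //; apply/memv_imgP/eqP => [[v _ ->] | ->].
    rewrite lfunE /=; congr coll_param; apply/rowP => j.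
    rewrite mxE !hcoord_mk7 //=.
    by case: j => [[|[|[|]]]] //= lt3; congr (v _ _); apply: val_inj.
  by eexists; [exact: memvf | rewrite lfunE].
have qU v : qform (coll_param x v) = 0.
  by rewrite /qform !hcoord_mk7 //= x4; ring.
exists (limg (linfun (coll_param x))); split=> // [|y|a qa aU].
- rewrite limg_dim_eq ?dimvf /dim /= ?mul1n //.
  rewrite (_ : lker _ = 0%VS) ?capv0 //; apply/eqP/lker0P => v w.
  rewrite !lfunE /= => eqvw.
  have e i := congr1 (fun y => hcoord y i) eqvw.
  have := (e 0, e 5, e 6)%N; rewrite !hcoord_mk7 //= => -[[e0 e5] e6].
  apply/rowP; case=> [[|[|[|]]]] //= lt3.
  + by rewrite (_ : Ordinal lt3 = 0) //; apply: val_inj.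
  + by rewrite (_ : Ordinal lt3 = 1) //; apply: val_inj.
  + by rewrite (_ : Ordinal lt3 = 2%:R) //; apply: val_inj.
- by case/memv_imgP=> v _ ->; rewrite lfunE qU.
rewrite memU coll_paramP //; set v := \row_j _; set b := coll_param x v.
have Uf w : coll_param x w \in limg (linfun (coll_param x)).
  by apply/memv_imgP; exists w; rewrite ?memvf ?lfunE.
(* Subtracting [b] reduces to [d] with coordinates 0, 5 and 6 equal to 0, for
   which [qform d = - d3 ^+ 2]. *)
have [d def_d] : exists d, d = a - b by exists (a - b).
have qd : qform d = 0.
  rewrite def_d qformD qa -[- b]scaleN1r qformZ qU bformZr aU ?Uf //; ring.
have Bd w : bform d (coll_param x w) = 0.
  rewrite bformC def_d bformDr -[- b]scaleN1r bformZr [bform _ a]bformC.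
  rewrite aU ?Uf //.
  have := qformD (coll_param x w) b; rewrite -linearD !qU !add0r => <-; ring.
have d0 : hcoord d 0 = 0 by rewrite def_d !hcoordE hcoord_mk7 //= mxE subrr.
have d5 : hcoord d 5 = 0 by rewrite def_d !hcoordE hcoord_mk7 //= mxE subrr.
have d6 : hcoord d 6 = 0 by rewrite def_d !hcoordE hcoord_mk7 //= mxE subrr.
have d3 : hcoord d 3 = 0.
  move: qd; rewrite /qform d0 d5 d6 !mulr0 mul0r !add0r => /eqP.
  by rewrite oppr_eq0 expf_eq0 => /eqP.
(* The images of the three unit vectors have a single 1 among coordinates 0, 5 and 6, which [bform]
   pairs with coordinates 4, 1 and 2 of [d]. *)
have dE s t u := Bd (\row_j [:: s; t; u]`_j).
have d4 : hcoord d 4 = 0.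
  by have := dE 1 0 0; rewrite /bform !hcoord_mk7 //= !mxE /=;
    rewrite d0 d3 d5 d6 => <-; ring.
have d1 : hcoord d 1 = 0.
  by have := dE 0 1 0; rewrite /bform !hcoord_mk7 //= !mxE /=;
    rewrite d0 d3 d4 d5 d6 => <-; ring.
have d2 : hcoord d 2 = 0.
  by have := dE 0 0 1; rewrite /bform !hcoord_mk7 //= !mxE /=;
    rewrite d0 d3 d4 d5 d6 => <-; ring.
rewrite -subr_eq0 -def_d; apply/eqP/hcoord7P; by rewrite hcoord0.
Qed.

Lemma coll_space_scale k x U :
  k != 0 -> coll_space (k *: x) U -> coll_space x U.
Proof.
move=> k0 [dU cU qU mU]; split=> // y; rewrite cU.
apply/idP/idP => [/(collZl k^-1)|/collZl//].
by rewrite scalerA mulVf // scale1r.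
Qed.

(** A nonzero singular vector has a nonzero coordinate other than number 3, since otherwise
    [qform x] is minus the square of coordinate 3. The maps [rot] and [swp] bring that coordinate to
    position 0, and scaling makes it 1. *)
Lemma coll_space_ex x : x != 0 -> qform x = 0 -> exists U, coll_space x U.
Proof.
have D0 y : hcoord y 0 != 0 -> qform y = 0 -> exists U, coll_space y U.
  move=> y0 qy; have [||U cU] := @coll_space_base ((hcoord y 0)^-1 *: y).
  - by rewrite hcoordE mulVf.
  - by rewrite qformZ qy mulr0.
  by exists U; apply: coll_space_scale cU; rewrite invr_eq0.
have Drot y : qform y = 0 -> (exists U, coll_space (rot y) U) ->
    exists U, coll_space y U.
  move=> qy [U]; apply: (@coll_space_transport rot (rot \o rot)).
  - exact: rotK3.
  - exact: rotK3.
  - exact: qform_rot.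
  exact: coll_rot.
have D1 y : hcoord y 1 != 0 -> qform y = 0 -> exists U, coll_space y U.
  by move=> y1 qy; apply/Drot/D0; rewrite ?qform_rot ?hcoord_mk7.
have D2 y : hcoord y 2 != 0 -> qform y = 0 -> exists U, coll_space y U.
  by move=> y1 qy; apply/Drot/D1; rewrite ?qform_rot ?hcoord_mk7.
have Dswp y : qform y = 0 -> (exists U, coll_space (swp y) U) ->
    exists U, coll_space y U.
  move=> qy [U]; apply: (@coll_space_transport swp swp).
  - exact: swpK.
  - exact: swpK.
  - exact: qform_swp.
  exact: coll_swp.
move=> x_neq0 qx.
have [x0|] := eqVneq (hcoord x 0) 0; last by move/D0; apply.
have [x1|] := eqVneq (hcoord x 1) 0; last by move/D1; apply.
have [x2|] := eqVneq (hcoord x 2) 0; last by move/D2; apply.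
have [x4|x4] := eqVneq (hcoord x 4) 0; last first.
  by apply/Dswp/D0; rewrite ?qform_swp ?hcoord_mk7.
have [x5|x5] := eqVneq (hcoord x 5) 0; last first.
  by apply/Dswp/D1; rewrite ?qform_swp ?hcoord_mk7.
have [x6|x6] := eqVneq (hcoord x 6) 0; last first.
  by apply/Dswp/D2; rewrite ?qform_swp ?hcoord_mk7.
case/eqP: x_neq0; apply: hcoord7P; rewrite ?hcoord0 //.
move: qx; rewrite /qform x0 x1 x2 !mul0r !add0r => /eqP.
by rewrite oppr_eq0 expf_eq0 => /eqP.
Qed.

End Coordinates.

(** * Graph distance and paths *)

Section GraphDistance.

Variables (T : finType) (e : rel T).

Lemma gdist_leq_path x p : path e x p -> (gdist e x (last x p) <= size p)%N.
Proof.
move=> ep; rewrite /gdist; set a := fun n => _.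
(* For a path of [#|T|] steps or more the bound is trivial: [find] never exceeds the length of the
   list it searches. *)
have [ltp|] := ltnP (size p) #|T|; last first.
  by apply: leq_trans; rewrite -[X in (_ <= X)%N](size_iota 0) find_size.
rewrite leqNgt; apply/negP => /(before_find 0%N).
rewrite nth_iota // add0n => /negbT/negP[].
by rewrite /a; apply/existsP; exists (in_tuple p); rewrite ep eqxx.
Qed.

(** The bound [n < #|T|] excludes the value [#|T|] that stands for a missing path. *)
Lemma path_of_gdist x y n : (gdist e x y <= n < #|T|)%N ->
  exists p, [/\ path e x p, last x p = y & (size p <= n)%N].
Proof.
rewrite /gdist; set a := fun n => _; case/andP=> len ltn.
have ltf : (find a (iota 0 #|T|) < #|T|)%N by apply: leq_ltn_trans ltn.
have := ltf; rewrite -[X in (_ < X)%N](size_iota 0) -has_find.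
move/(nth_find 0%N); rewrite nth_iota // add0n.
move: (find _ _) len {ltf} => k kn; rewrite /a.
case/existsP=> p /andP[ep /eqP lp]; exists p.
by rewrite ep lp size_tuple.
Qed.

End GraphDistance.

(** * Points, lines and planes of the hexagon through generating vectors *)

Section Hexagon.

Local Open Scope ring_scope.

Variable F : finFieldType.
Local Notation V := 'rV[F]_7.
Implicit Types (x y z a : V) (U S : {vspace V}).
Implicit Types (X Y Z A p : hpoint F) (n l : hline F).

Definition gen X : V := vpick (val X).

Lemma gen_span X : val X = <[gen X]>%VS.
Proof.
have /andP[/eqP dX _] := valP X; apply/esym/eqP; rewrite eqEdim.
by rewrite -memvE memv_pick dX dim_vline vpick0 -dimv_eq0 dX.
Qed.

Lemma gen_neq0 X : gen X != 0.
Proof. by have /andP[/eqP dX _] := valP X; rewrite vpick0 -dimv_eq0 dX. Qed.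

Lemma qform_gen X : qform (gen X) = 0.
Proof.
by have /andP[_ /forallP/(_ (gen X))] := valP X; rewrite memv_pick => /eqP.
Qed.

Lemma gen_sub X U : (val X <= U)%VS = (gen X \in U).
Proof. by rewrite gen_span -memvE. Qed.

Lemma hpoint_of x : x != 0 -> qform x = 0 ->
  exists X : hpoint F, val X = <[x]>%VS.
Proof.
move=> x0 qx; have hx : is_hpoint <[x]>.
  rewrite /is_hpoint dim_vline x0; apply/forallP => y; apply/implyP.
  by case/vlineP=> k ->; rewrite qformZ qx mulr0.
by exists (Sub <[x]>%VS hx).
Qed.

Lemma hpoint_gen x : x != 0 -> qform x = 0 ->
  exists X k, k != 0 /\ gen X = k *: x.
Proof.
move=> x0 qx; have [X vX] := hpoint_of x0 qx; exists X.
have /vlineP[k gX] : gen X \in <[x]>%VS by rewrite -vX memv_pick.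
exists k; split=> //; apply: contraNneq (gen_neq0 X) => k0.
by rewrite gX k0 scale0r.
Qed.

Lemma hpoint_eq X Y : gen Y \in val X -> Y = X.
Proof.
move=> YX; apply/val_inj/eqP; rewrite eqEdim gen_sub YX.
by rewrite !gen_span !dim_vline !gen_neq0.
Qed.

Lemma qform_hline n x : x \in val n -> qform x = 0.
Proof.
by have /and3P[_ /forallP/(_ x) + _] := valP n => + xn; rewrite xn => /eqP.
Qed.

Lemma dim_hline n : \dim (val n) = 2.
Proof. by have /and3P[/eqP] := valP n. Qed.

Lemma dim_span2 x y : x != 0 -> y \notin <[x]>%VS -> \dim (<[x]> + <[y]>) = 2.
Proof.
move=> x0 yx; have : free [:: y; x] by rewrite free_cons span_seq1 yx seq1_free.
by rewrite /free !span_cons span_nil addv0 addvC => /eqP.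
Qed.

Lemma span2_hline n x y : x \in val n -> y \in val n ->
  x != 0 -> y \notin <[x]>%VS -> val n = (<[x]> + <[y]>)%VS.
Proof.
move=> xn yn x0 yx; apply/esym/eqP; rewrite eqEdim dim_hline dim_span2 //.
by rewrite subv_add -!memvE xn yn.
Qed.

(** For proportional vectors, which [is_hline] leaves out, all Grassmann coordinates vanish. *)
Lemma hline_coll n x y : x \in val n -> y \in val n -> coll x y.
Proof.
move=> xn yn; have := qformD x y.
rewrite !(qform_hline (n := n)) ?memvD // !add0r /coll => <-.
rewrite eqxx andbT.
have [->|x0] := eqVneq x 0; first by rewrite titsC -(scale0r y) titsZr ?titsxx.
have [/vlineP[k ->]|yx] := boolP (y \in <[x]>%VS).
  by rewrite titsZr ?titsxx.
have /and3P[_ _ /forallP/(_ x)/forallP/(_ y)/implyP] := valP n.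
by apply; apply/eqP/span2_hline.
Qed.

Lemma is_hline_span2 x y : x != 0 -> y \notin <[x]>%VS ->
  qform x = 0 -> qform y = 0 -> coll x y -> is_hline (<[x]> + <[y]>)%VS.
Proof.
move=> x0 yx qx qy cxy.
have mem u : u \in (<[x]> + <[y]>)%VS -> exists b c, u = b *: x + c *: y.
  by case/memv_addP=> _ /vlineP[b ->] [_ /vlineP[c ->] ->]; exists b, c.
rewrite /is_hline dim_span2 // eqxx /=; apply/andP; split.
  apply/forallP=> u; apply/implyP=> /mem[b [c ->]].
  case/andP: cxy => _ /eqP Bxy.
  rewrite qformD !qformZ qx qy bformZr bformC bformZr bformC Bxy.
  by apply/eqP; ring.
apply/forallP=> u; apply/forallP=> v; apply/implyP=> /eqP uv.
have /mem[b [c ->]] : u \in (<[x]> + <[y]>)%VS.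
  by rewrite uv memvE addvSl.
have /mem[b' [c' ->]] : v \in (<[x]> + <[y]>)%VS.
  by rewrite uv memvE addvSr.
suff /andP[] : coll (b *: x + c *: y) (b' *: x + c' *: y) by [].
have cx : coll x (b' *: x + c' *: y) by rewrite collDr ?collZr ?collxx.
have cy : coll y (b' *: x + c' *: y) by rewrite collDr ?collZr ?collxx // collC.
by rewrite collC collDr ?collZr // collC.
Qed.

Lemma coll_spaceX X : exists U, coll_space (gen X) U.
Proof. exact: coll_space_ex (gen_neq0 X) (qform_gen X). Qed.

Lemma hline_through X y : qform y = 0 -> coll (gen X) y ->
  exists n, hincident X n && (y \in val n).
Proof.
move=> qy cXy; have X0 := gen_neq0 X; have qX := qform_gen X.
have [yX|yX] := boolP (y \in <[gen X]>%VS); last first.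
  exists (Sub _ (is_hline_span2 X0 yX qX qy cXy)).
  by rewrite /hincident gen_sub /= !memvE addvSl addvSr.
(* Here [y] is a multiple of [gen X], so any line on [X] will do; a second vector comes from the
   hexagon plane of [X]. *)
have [U [dU cU qU _]] := coll_spaceX X.
have /subvPn[w wU wX] : ~~ (U <= <[gen X]>)%VS.
  by apply: contraTN isT => /dimvS; rewrite dU dim_vline X0.
exists (Sub _ (is_hline_span2 X0 wX qX (qU _ wU) (etrans (esym (cU w)) wU))).
have sub : (<[gen X]> <= <[gen X]> + <[w]>)%VS by rewrite addvSl.
by rewrite /hincident gen_sub /= !(subvP sub) ?memv_line.
Qed.

Lemma hplane_coll A y : y \in hplane A -> coll (gen A) y.
Proof.
have [U [_ cU _ _]] := coll_spaceX A; rewrite -cU; apply/subvP.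
apply/subv_sumP => n An; apply/subvP => u un.
by rewrite cU (@hline_coll n) // -gen_sub.
Qed.

Lemma coll_hplane A y : qform y = 0 -> coll (gen A) y -> y \in hplane A.
Proof.
move=> qy /(hline_through qy)[n /andP[An yn]].
by apply: subvP yn; apply: (sumv_sup n).
Qed.

(** Keeps distances up to 4 apart from the value of [gdist] for a missing path. The six unit vectors
    other than number 3 already span distinct points. *)
Lemma card_hexagon : (4 < #|{: hpoint F + hline F}|)%N.
Proof.
have sing (i : {i : 'I_7 | val i != 3}) :
    exists X : hpoint F, val X == <[delta_mx ord0 (val i) : V]>%VS.
  have [||X vX] := @hpoint_of (delta_mx ord0 (val i)).
  3: by exists X; rewrite vX.
    apply/eqP => /rowP/(_ (val i)); rewrite !mxE !eqxx => /eqP.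
    by rewrite oner_eq0.
  case: i => [[[|[|[|[|[|[|[|]]]]]]] //= lti] // _];
  rewrite /qform /hcoord !mxE -!val_eqE /= !inordK //=; ring.
pose f i : hpoint F + hline F := inl (xchoose (sing i)).
have injf : injective f.
  move=> i j [] eqij; apply/val_inj/eqP; have := eqP (xchooseP (sing i)).
  rewrite eqij (eqP (xchooseP (sing j))) => eqv.
  have : (delta_mx ord0 (val i) : V) \in <[delta_mx ord0 (val j) : V]>%VS.
    by rewrite eqv memv_line.
  case/vlineP=> k /rowP/(_ (val i)); rewrite !mxE !eqxx /=.
  by case: eqP => // _ /eqP; rewrite mulr0 oner_eq0.
apply: leq_trans (leq_card f injf).
by rewrite card_sig (@eq_card _ _ (predC1 (inord 3))) ?cardC1 ?card_ord // => i;
  rewrite !inE -val_eqE /= inordK.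
Qed.

(** * Distances in terms of collinearity and perpendicularity *)

Lemma incidence_hexagon_path4 X n Z m Y :
  hincident X n -> hincident Z n -> hincident Z m -> hincident Y m ->
  (hdist X Y <= 4)%N.
Proof.
move=> Xn Zn Zm Ym.
apply: (@gdist_leq_path _ _ (inl X) [:: inr n; inl Z; inr m; inl Y]).
by rewrite /= Xn Zn Zm Ym.
Qed.

Lemma hdist_le4P X A : reflect
  (exists Z, coll (gen X) (gen Z) /\ coll (gen Z) (gen A)) (hdist X A <= 4)%N.
Proof.
apply: (iffP idP) => [d4 | [Z [cXZ cZA]]].
  have [|p [ep lp sp]] := @path_of_gdist _ (incidence_graph (@hincident F))
    (inl X) (inl A) 4; first by rewrite d4 card_hexagon.
  have cc Y n Z : hincident Y n -> hincident Z n -> coll (gen Y) (gen Z).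
    by rewrite /hincident !gen_sub; apply: hline_coll.
  have cYY Y : coll (gen Y) (gen Y) by rewrite collxx ?qform_gen.
  (* The incidence graph is bipartite, so only lengths 0, 2 and 4 survive; in the shorter cases [Z]
     coincides with an end point. *)
  case: p => [|[?|n] [|[Z|?] [|[?|m] [|[Y|?] [|? ?]]]]] //= in ep lp sp;
    case: lp => [<-]; rewrite ?andbF //= in ep *.
  - by exists X.
  - by exists Z; have /and3P[Xn Zn _] := ep; split=> //; apply: cc Zn.
  - have /and5P[Xn Zn Zm Ym _] := ep.
    by exists Z; split; [apply: cc Zn|apply: cc Ym].
have [n /andP[Xn Zn]] := hline_through (qform_gen Z) cXZ.
have [m /andP[Zm Am]] := hline_through (qform_gen A) cZA.
by apply: (@incidence_hexagon_path4 _ n Z m); rewrite // /hincident gen_sub.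
Qed.

Lemma hdistxx X : hdist X X = 0%N.
Proof.
apply/eqP; rewrite -leqn0.
exact: (@gdist_leq_path _ (incidence_graph (@hincident F)) (inl X) [::] isT).
Qed.

Lemma Gamma2P X Y : reflect
  (Y != X /\ exists n, hincident X n && hincident Y n) (Y \in Gamma2 X).
Proof.
rewrite inE; apply: (iffP eqP) => [d2 | [YX [n /andP[Xn Yn]]]].
  have [|p [ep lp sp]] := @path_of_gdist _ (incidence_graph (@hincident F))
    (inl X) (inl Y) 2.
    by rewrite (_ : gdist _ _ _ = 2) // (leq_trans _ card_hexagon).
  have YX : Y != X by apply: contra_eq_neq d2 => ->; rewrite hdistxx.
  split=> //; case: p => [|[?|n] [|[Z|?] [|? ?]]] //= in ep lp sp;
    case: lp => E.
    by rewrite E eqxx in YX.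
  by exists n; move: ep; rewrite -E andbT.
have d2 : (hdist X Y <= 2)%N.
  apply: (@gdist_leq_path _ _ (inl X) [:: inr n; inl Y]).
  by rewrite /= Xn Yn.
apply/eqP; rewrite eqn_leq d2 leqNgt ltnS; apply/negP => d1.
have [|p [ep lp sp]] := @path_of_gdist _ (incidence_graph (@hincident F))
    (inl X) (inl Y) 1.
  by rewrite [gdist _ _ _]/(hdist X Y) d1 (leq_trans _ card_hexagon).
case: p => [|[?|m] [|? ?]] //= in ep lp sp; case: lp => E.
by rewrite E eqxx in YX.
Qed.

Lemma Gamma2_coll X Y : Y \in Gamma2 X = (Y != X) && coll (gen X) (gen Y).
Proof.
apply/Gamma2P/andP => [[YX [n /andP[Xn Yn]]] | [YX /hline_through cXY]].
  by split=> //; apply: (@hline_coll n); rewrite -gen_sub.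
split=> //; have [n /andP[Xn Yn]] := cXY (qform_gen Y).
by exists n; rewrite Xn /hincident gen_sub.
Qed.

(** A common neighbour [Z] puts both generators in its totally singular plane, so they are
    perpendicular. Conversely the product [cross] supplies the neighbour. *)
Lemma hdist_le4_perp X A : (hdist X A <= 4)%N = (bform (gen A) (gen X) == 0).
Proof.
rewrite bformC; apply/hdist_le4P/eqP => [[Z [cXZ cZA]] | BXA].
  have [U [_ cU qU _]] := coll_spaceX Z.
  have := qformD (gen X) (gen A).
  by rewrite qU ?memvD ?cU // 1?collC // !qform_gen !add0r => <-.
have [cXz cAz] := coll_cross (qform_gen X) (qform_gen A) BXA.
(* A zero product spans no point, but then [X] and [A] are themselves collinear. *)
have [/(cross_eq0 BXA) cXA|z0] := eqVneq (cross (gen X) (gen A)) 0.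
  by exists X; rewrite collxx ?qform_gen.
have [U [_ cU qU _]] := coll_spaceX X.
have [|Z [k [_ gZ]]] := hpoint_gen z0; first by apply: qU; rewrite cU.
by exists Z; rewrite gZ; split; rewrite 1?[coll _ (gen A)]collC collZr.
Qed.

(* If [A] is collinear with no point of [n] but [n] is in its perp, pick [x] on
   [n]: then [A^perp] cuts the hexagon plane of [x] exactly in [n], which
   therefore contains the common neighbour [cross] of [A] and [x]. *)
Lemma hline_perp n A : (forall y, y \in val n -> bform (gen A) y = 0) ->
  exists y, [/\ y \in val n, y != 0 & coll (gen A) y].
Proof.
move=> nA; set x := vpick (val n).
have xn : x \in val n by apply: memv_pick.
have x0 : x != 0 by rewrite vpick0 -dimv_eq0 dim_hline.
have qx := qform_hline xn.
have [cAx|ncAx] := boolP (coll (gen A) x); first by exists x.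
have [cAz cxz] := coll_cross (qform_gen A) qx (nA x xn).
set z := cross _ _ in cAz cxz.
exists z; split=> //; last by apply: contraNneq ncAx => /(cross_eq0 (nA x xn)).
have [U [dU cU qU mU]] := coll_space_ex x0 qx.
(* Were [z] off the line, the line and [z] would span [U], and the maximality [mU] would put [gen A]
   in [U]. *)
apply: contraNT ncAx => zn; rewrite collC -cU mU ?qform_gen // => y yU.
have nU : (val n <= U)%VS by apply/subvP => u un; rewrite cU (@hline_coll n).
suff : y \in (val n + <[z]>)%VS.
  case/memv_addP=> u un [_ /vlineP[k ->] ->]; rewrite bformDr bformZr nA //.
  by have /andP[_ /eqP->] := cAz; rewrite mulr0 addr0.
suff -> : (val n + <[z]>)%VS = U by [].
apply/eqP; rewrite eqEdim subv_add nU -memvE cU cxz dU /=.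
suff: (\dim (val n) < \dim (val n + <[z]>))%N by rewrite dim_hline.
rewrite ltn_neqAle dimvS ?addvSl // andbT.
rewrite (dimv_leqif_eq (addvSl _ _)); apply: contraNneq zn => ->.
by rewrite memvE addvSr.
Qed.

(** * The two conditions of a 1-good structure *)

Lemma unique_line S A p : p \notin P1 A :|: P2 S :|: P3 S ->
  #|[set l in L1 S :|: L2 A | hincident p l]| = 1%N.
Proof.
rewrite !inE !negb_or !negb_and !negbK => /andP[/andP[pA pS]].
rewrite (negPf pS) /= => /cards1P[R defR].
have /setIP[pR RS] : R \in Gamma2 p :&: points_in S by rewrite defR set11.
have /Gamma2P[Rp [n0 /andP[pn0 Rn0]]] := pR.
rewrite inE gen_sub in RS.
apply/eqP/cards1P; exists n0; apply/setP => l; rewrite !inE.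
apply/andP/eqP => [[lL pl] | ->]; last first.
  split=> //; apply/orP; left; rewrite -subv0; apply/subvPn.
  by exists (gen R); rewrite ?memv0 ?gen_neq0 // memv_cap RS -gen_sub andbT.
have capP (U : {vspace 'rV[F]_7}) : (val l :&: U != 0)%VS ->
    exists w k W, [/\ k != 0, gen W = k *: w, w \in val l & w \in U].
  rewrite -vpick0; set w := vpick _ => w0.
  have := memv_pick (val l :&: U)%VS; rewrite memv_cap => /andP[wl wU].
  have [W [k [k0 gW]]] := hpoint_gen w0 (qform_hline wl).
  by exists w, k, W.
(* The case of a line meeting the plane of [A] comes first: its point [W] there would be a common
   neighbour of [p] and [A]. *)
case/orP: lL => /capP[w [k [W [k0 gW wl wU]]]]; last first.
  case/hdist_le4P: pA; exists W; rewrite gW; split; last first.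
    by rewrite collC collZr // hplane_coll.
  by apply: (@hline_coll l); rewrite ?memvZ // -gen_sub.
have WS : (val W <= S)%VS by rewrite gen_sub gW memvZ.
have Wl : hincident W l by rewrite /hincident gen_sub gW memvZ.
have: W \in Gamma2 p :&: points_in S.
  apply/setIP; split; last by rewrite inE.
  apply/Gamma2P; split.
    by apply: contraNneq pS => <-.
  by exists l; rewrite pl.
rewrite defR => /set1P WR; rewrite WR in Wl.
have RnP : gen R \notin <[gen p]>%VS.
  by apply: contra Rp; rewrite -gen_span => /hpoint_eq->.
(* Two distinct points determine a line, so [l] and [n0], both on [p] and [R], coincide. *)
have spanpR n : hincident p n -> hincident R n ->
    val n = (<[gen p]> + <[gen R]>)%VS.
  rewrite /hincident !gen_sub => pn Rn.
  exact: span2_hline (gen_neq0 p) RnP.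
by apply: val_inj; rewrite (spanpR l) // (spanpR n0).
Qed.

Lemma unique_point S A l : \dim S = 5%N -> l \notin L1 S :|: L2 A ->
  #|[set p in P1 A :|: P2 S :|: P3 S | hincident p l]| = 1%N.
Proof.
pose a := gen A; move=> hS.
rewrite !inE negb_or !negbK => /andP[/eqP lS /eqP lA].
have [w [wl w0 Bw]] : exists w, [/\ w \in val l, w != 0 & bform a w = 0].
  have x0 : vpick (val l) != 0 by rewrite vpick0 -dimv_eq0 dim_hline.
  have xl := memv_pick (val l); set x := vpick _ in x0 xl.
  have /subvPn[y yl yx] : ~~ (val l <= <[x]>)%VS.
    by apply: contraTN isT => /dimvS; rewrite dim_hline dim_vline x0.
  have [Bax|Bax] := eqVneq (bform a x) 0; first by exists x.
  (* A linear form vanishes somewhere on a 2-dimensional space: subtracting the right multiple of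
     [x] from an independent [y] gives a nonzero vector of its kernel. *)
  exists (y - (bform a y / bform a x) *: x); split.
  - by rewrite memvB // memvZ.
  - apply: contraNneq yx => /eqP; rewrite subr_eq0 => /eqP->.
    by rewrite memvZ ?memv_line.
  by rewrite -scaleNr bformDr bformZr mulNr divfK // subrr.
have [R [k [k0 gR]]] := hpoint_gen w0 (qform_hline wl).
have Rl : hincident R l by rewrite /hincident gen_sub gR memvZ.
have Ra : bform a (gen R) = 0 by rewrite gR bformZr Bw mulr0.
apply/eqP/cards1P; exists R; apply/setP => p; rewrite !inE.
apply/andP/eqP => [[pP pl] | ->]; last first.
  by split=> //; rewrite hdist_le4_perp Ra eqxx.
have pS : ~~ (val p <= S)%VS.
  apply: contra (gen_neq0 p) => pS; rewrite -memv0 -lS memv_cap.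
  by rewrite -!gen_sub pS andbT.
rewrite (negPf pS) orbF /= in pP; case/orP: pP => [|/eqP[]].
  rewrite hdist_le4_perp => /eqP pa.
  apply/eqP; apply: contraT => pR.
  (* Two distinct points of [l] perpendicular to [A] would put all of [l] in the perp of [A], and
     [hline_perp] would then make [l] meet the plane of [A]. *)
  have pnR : gen p \notin <[gen R]>%VS.
    by apply: contra pR; rewrite -gen_span => /hpoint_eq->.
  have [|y [yl y0 cay]] := @hline_perp l A.
    rewrite /hincident !gen_sub in Rl pl.
    rewrite (span2_hline Rl pl (gen_neq0 R) pnR) => y.
    case/memv_addP=> _ /vlineP[b ->] [_ /vlineP[c ->] ->].
    by rewrite bformDr !bformZr pa Ra !mulr0 addr0.
  case/negP: y0; rewrite -memv0 -lA memv_cap yl coll_hplane //.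
  exact: qform_hline yl.
have [U [dU cU qU _]] := coll_spaceX p.
have lU : (val l <= U)%VS.
  by apply/subvP => u ul; rewrite cU (@hline_coll l) -?gen_sub.
(* Inside the 3-dimensional [U], the 2-dimensional [l] leaves room for at most one dimension
   disjoint from it. *)
have dUS : (\dim (U :&: S) <= 1)%N.
  have capl : (val l :&: (U :&: S) = 0)%VS.
    by rewrite capvA [(val l :&: U)%VS]capvC -capvA lS capv0.
  have /dimvS : (val l + (U :&: S) <= U)%VS by rewrite subv_add lU capvSl.
  by rewrite dU dimv_disjoint_sum // dim_hline.
(* The dimensions 3 and 5 add up to 8, more than the 7 of the whole space. *)
have US0 : (U :&: S != 0)%VS.
  rewrite -dimv_eq0 -lt0n -(ltn_add2l (\dim (U + S))) addn0 dimv_sum_cap dU hS.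
  by rewrite (leq_ltn_trans (dimvS (subvf _))) // dimvf /dim /= mul1n.
move: US0; rewrite -vpick0; set u := vpick _ => u0.
have := memv_pick (U :&: S)%VS; rewrite -/u memv_cap => /andP[uU uS].
have [W [c [c0 gW]]] := hpoint_gen u0 (qU _ uU).
have defUS : (U :&: S = <[u]>)%VS.
  apply/esym/eqP; rewrite eqEdim dim_vline u0 dUS andbT.
  by rewrite -memvE memv_cap uU uS.
apply/eqP/cards1P; exists W; apply/setP => Y; rewrite in_setI Gamma2_coll -cU.
rewrite !inE gen_sub; apply/andP/eqP => [[/andP[_ YU] YS] | ->].
  apply: hpoint_eq; rewrite gen_span gW.
  have /vlineP[d ->] : gen Y \in <[u]>%VS by rewrite -defUS memv_cap YU.
  apply/vlineP; exists (d / c); by rewrite scalerA divfK.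
rewrite gW !memvZ // andbT; split=> //.
(* [Gamma2 p] leaves out [p] itself, but [W] is in [S] and [p] is not. *)
by apply: contraNneq pS => <-; rewrite gen_sub gW memvZ.
Qed.

End Hexagon.

Theorem theorem5p1 (F : finFieldType) (S : {vspace 'rV[F]_7})
    (hS : \dim S = 5) (A : hpoint F) (hA : (val A <= S)%VS) :
  one_good (@hincident F) (P1 A :|: P2 S :|: P3 S) (L1 S :|: L2 A).
Proof.
split=> [p | l]; first exact: unique_line.
exact: unique_point.
Qed.
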